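(* For each nonempty rooted forest $f$ let $\psi_f:=[f,R_x]=f\circ R_x-R_x\circ f$ (a linear map $\mathfrak{H}\to\mathfrak{H}$). Then there exist $\mathbb{Q}$-linear maps $\phi_f:\mathfrak{H}\to\mathfrak{H}$, one for each nonempty rooted forest $f$, such that for all nonempty rooted forests $f,g$: (a) $\psi_f=R_y\phi_fR_x$; (b) $f(\mathbb{Q}x+\mathbb{Q}y+\mathfrak{H}^0)\subset x\mathfrak{H}y$; (c) $\phi_{B_+(f)}=f+R_z\phi_f$; (d) $\phi_f$ lies in the $\mathbb{Q}$-linear span of the composites $R_z^{k}\circ t_1\circ\cdots\circ t_m$ ($k,m\ge 0$, $t_1,\dots,t_m$ rooted tree maps) with $k+\deg t_1+\cdots+\deg t_m=\deg f-1$; (e) $f\circ g=g\circ f$; (f) $f(vw)=M(\Delta(f)(v\otimes w))$ for all $v,w\in\mathfrak{H}$.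
   Context: A rooted tree is a finite non-planar tree with a distinguished root; a rooted forest is a finite multiset (commutative product) of rooted trees, the empty forest being $\mathbb{I}$; $\deg$ of a forest is its number of vertices. $H$ is the commutative $\mathbb{Q}$-algebra with basis the rooted forests (product = disjoint union). $B_+$ sends a forest $t_1\cdots t_n$ to the tree obtained by adding a new root joined to the roots of the $t_i$; $B_+(\mathbb{I})=\bullet$ (one-vertex tree). The coproduct $\Delta:H\to H\otimes H$ is the algebra homomorphism with $\Delta(\mathbb{I})=\mathbb{I}\otimes\mathbb{I}$, $\Delta(B_+(f))=B_+(f)\otimes\mathbb{I}+(\mathrm{id}\otimes B_+)\Delta(f)$. $\mathfrak{H}=\mathbb{Q}\langle x,y\rangle$, $z=x+y$, $R_u(w)=wu$, $L_u(w)=uw$, $R_y^{-1}$ is the inverse of $R_y$ on $\mathfrak{H}y$, $M(v\otimes w)=vw$, $\mathfrak{H}^0=\mathbb{Q}+x\mathfrak{H}y$. Rooted forest maps: to each rooted forest $f$ is attached a $\mathbb{Q}$-linear map $\mathfrak{H}\to\mathfrak{H}$ (also denoted $f$), the identity for $\mathbb{I}$, determined by: $\bullet(x)=xy$, $\bullet(y)=-xy$; for nonempty $f$ and $u\in\{x,y\}$, $f(u)\in\mathfrak{H}y$ and $B_+(f)(u)=R_yR_{y+z}R_y^{-1}f(u)$; if $f=gh$ with $g,h\ne\mathbb{I}$ then $f(u)=g(h(u))$; and for nonempty $f$, $w\in\mathfrak{H}$, $u\in\{x,y\}$, $f(wu)=M(\Delta(f)(w\otimes u))$, where for $\Delta(f)=\sum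 a\otimes b$ one sets $\Delta(f)(v\otimes w)=\sum a(v)\otimes b(w)$. Such a family of maps exists. A rooted tree map is the map attached to a rooted tree. *)

(* Defs.v *)
From HB Require Import structures.
From mathcomp Require Import all_boot all_order all_algebra finmap.
From mathcomp.multinomials Require Import monalg.

Set Implicit Arguments.
Unset Strict Implicit.
Unset Printing Implicit Defensive.

Import GRing.Theory.
Local Open Scope ring_scope.

(* Rooted trees: planar trees modulo reordering of branches, represented by
   their recursively sorted normal form. *)

Inductive ptree := PNode of seq ptree.

Fixpoint ptree_all_ind (P : ptree -> Prop)
    (IH : forall s, (forall i, (i < size s)%N -> P (nth (PNode [::]) s i)) ->
      P (PNode s)) (t : ptree) : P t :=
  let: PNode s := t in IH s
    ((fix loop s : forall i, (i < size s)%N -> P (nth (PNode [::]) s i) :=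
      match s with
      | [::] => fun i h => False_ind _ (notF (etrans (esym (ltn0 i)) h))
      | t :: s' => fun i => match i with
          | 0%N => fun=> ptree_all_ind IH t
          | i'.+1 => fun h => loop s' i' h
          end
      end) s).

Fixpoint ptree_code (t : ptree) : GenTree.tree unit :=
  let: PNode s := t in GenTree.Node 0 (map ptree_code s).

Fixpoint ptree_decode (t : GenTree.tree unit) : ptree :=
  match t with
  | GenTree.Leaf _ => PNode [::]
  | GenTree.Node _ s => PNode (map ptree_decode s)
  end.

Lemma ptree_codeK : cancel ptree_code ptree_decode.
Proof.
elim/ptree_all_ind => s IH /=; congr PNode; rewrite -map_comp.
apply: (@eq_from_nth _ (PNode [::])); rewrite size_map // => i lt_i.
by rewrite (nth_map (PNode [::])) //= IH.
Qed.

HB.instance Definition _ := Countable.copy ptree (can_type ptree_codeK).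

Definition ptree_le (t u : ptree) : bool := (choice.pickle t <= choice.pickle u)%N.

Lemma ptree_le_total : total ptree_le.
Proof. by move=> t u; exact: leq_total. Qed.

Lemma ptree_le_trans : transitive ptree_le.
Proof. by move=> t u v; exact: leq_trans. Qed.

Lemma ptree_le_anti : antisymmetric ptree_le.
Proof.
by move=> t u; rewrite /ptree_le -eqn_leq => /eqP /(pcan_inj choice.pickleK).
Qed.

Fixpoint canon (t : ptree) : ptree :=
  let: PNode s := t in PNode (sort ptree_le (map canon s)).

Lemma ptree_ind_in (P : ptree -> Prop) :
  (forall s, {in s, forall t, P t} -> P (PNode s)) -> forall t, P t.
Proof.
move=> H; elim/ptree_all_ind => s IH; apply: H => t /(nthP (PNode [::])).
by case=> i lt_i <-; exact: IH.
Qed.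

Lemma canon_id t : canon (canon t) = canon t.
Proof.
elim/ptree_ind_in: t => s IH /=; congr PNode; rewrite map_id_in.
  exact/(sorted_sort ptree_le_trans)/(sort_sorted ptree_le_total).
by move=> t; rewrite mem_sort => /mapP[u us ->]; exact: IH.
Qed.

Record tree := Tree { tval :> ptree; _ : canon tval == tval }.
HB.instance Definition _ := [isSub for tval].
HB.instance Definition _ := [Countable of tree by <:].

Definition mktree (t : ptree) : tree := Tree (introT eqP (canon_id t)).

Lemma canon_tval (t : tree) : canon (tval t) = tval t.
Proof. by apply/eqP; case: t. Qed.

Lemma tvalK (t : tree) : mktree (tval t) = t.
Proof. by apply/val_inj; exact: canon_tval. Qed.

(* A rooted forest is a finite multiset of trees; the empty forest is [mone]
   and the commutative product of forests is [mmul]. *)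
Notation forest := {cmonom tree}.

Definition tree_forest (t : tree) : forest := ucm t.

Definition forest_seq (f : forest) : seq tree :=
  flatten [seq nseq (f t) t | t <- finsupp (cmonom_val f)].

Definition Bplus (f : forest) : tree := mktree (PNode (map tval (forest_seq f))).

Fixpoint ptree_deg (t : ptree) : nat :=
  let: PNode s := t in (sumn (map ptree_deg s)).+1.

Definition deg (f : forest) : nat :=
  \sum_(t <- finsupp (cmonom_val f)) (f t * ptree_deg t)%N.

Definition seq_forest (s : seq tree) : forest :=
  \big[mmul/mone]_(t <- s) tree_forest t.

Definition branches (t : tree) : forest :=
  let: PNode s := tval t in seq_forest (map mktree s).

Lemma seq_forestE s t : seq_forest s t = count_mem t s.
Proof.
rewrite /seq_forest; elim: s => [|u s IH]; first by rewrite big_nil cm1.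
by rewrite big_cons cmM IH /= /tree_forest cmU.
Qed.

Lemma count_forest_seq (f : forest) t : count_mem t (forest_seq f) = f t.
Proof.
rewrite /forest_seq count_flatten -map_comp sumnE big_map.
have -> : (\sum_(u <- finsupp (cmonom_val f)) (count_mem t \o (fun u => nseq (f u) u)) u
   = \sum_(u <- finsupp (cmonom_val f)) (u == t) * f u)%N.
  by apply: eq_bigr => u _; rewrite /= count_nseq.
have [tf|tf] := boolP (t \in finsupp (cmonom_val f)).
  rewrite (bigD1_seq t) ?fset_uniq //= eqxx mul1n big1 ?addn0 // => u.
  by move=> /negbTE ->.
rewrite big_seq big1 => [|u uf]; last first.
  by case: eqP => // eu; rewrite -eu uf in tf.
by apply/esym/eqP; rewrite cmE_eq0.
Qed.

Lemma forest_seqK : cancel forest_seq seq_forest.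
Proof. by move=> f; apply/eqP/cmP => t; rewrite seq_forestE count_forest_seq. Qed.

Lemma seq_forest_perm s1 s2 : perm_eq s1 s2 -> seq_forest s1 = seq_forest s2.
Proof. by move=> /permP p; apply/eqP/cmP => t; rewrite !seq_forestE p. Qed.

Lemma perm_seq_forest s : perm_eq (forest_seq (seq_forest s)) s.
Proof. by apply/allP => t _ /=; rewrite count_forest_seq seq_forestE. Qed.

Lemma tval_Bplus f :
  tval (Bplus f) = PNode (sort ptree_le (map tval (forest_seq f))).
Proof.
rewrite /Bplus /= -map_comp; congr (PNode (sort _ _)).
by apply: eq_map => t /=; exact: canon_tval.
Qed.

Lemma BplusK : cancel Bplus branches.
Proof.
move=> f; rewrite /branches tval_Bplus -[RHS]forest_seqK.
apply: seq_forest_perm; rewrite -[X in perm_eq _ X](mapK tvalK).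
by apply: perm_map; rewrite perm_sort.
Qed.

Lemma branchesK : cancel branches Bplus.
Proof.
move=> t; apply/val_inj; rewrite [LHS]tval_Bplus -[RHS]canon_tval.
rewrite /branches; case: (tval t) => s /=; congr PNode.
have -> : map canon s = map tval (map mktree s) by rewrite -map_comp.
apply/(perm_sortP ptree_le_total ptree_le_trans ptree_le_anti)/perm_map.
exact: perm_seq_forest.
Qed.

Lemma Bplus_bij : bijective Bplus.
Proof. by exists branches; [exact: BplusK | exact: branchesK]. Qed.

Lemma ptree_deg_canon t : ptree_deg (canon t) = ptree_deg t.
Proof.
elim/ptree_ind_in: t => s IH /=; congr _.+1; rewrite !sumnE !big_map.
rewrite (perm_big (map canon s)) ?perm_sort //= big_map !big_seq.
exact: eq_bigr.
Qed.

Lemma deg_seq f : deg f = \sum_(t <- forest_seq f) ptree_deg t.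
Proof.
rewrite /forest_seq big_flatten big_map /deg; apply: eq_bigr => t _.
by rewrite big_nseq iter_addn_0 mulnC.
Qed.

Lemma deg_Bplus f : deg (tree_forest (Bplus f)) = (deg f).+1.
Proof.
rewrite {1}/deg /tree_forest mdomU big_seq_fset1 cmUU mul1n.
by rewrite [LHS]ptree_deg_canon /= deg_seq sumnE -map_comp big_map.
Qed.

Lemma degM f g : deg (mmul f g) = (deg f + deg g)%N.
Proof.
have degE h d : (finsupp (cmonom_val h) `<=` d)%fset ->
    deg h = (\sum_(t <- d) h t * ptree_deg t)%N.
  move=> le_hd; rewrite /deg (big_fset_incl _ le_hd) // => t _.
  by rewrite -cmE_eq0 => /eqP ->.
rewrite (degE f _ (fsubsetUl _ (finsupp (cmonom_val g)))).
rewrite (degE g _ (fsubsetUr (finsupp (cmonom_val f)) _)) /deg mdomD -big_split.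
by apply: eq_bigr => t _; rewrite cmM mulnDl.
Qed.

(* The algebra [H] and, on the product basis, the tensor square [H (x) H];
   [<< (f, g) >>] stands for the pure tensor of the forests f and g. *)

Section PairMonom.
Variables K1 K2 : monomType.
Implicit Types p q : K1 * K2.

Definition pmone : K1 * K2 := (mone, mone).
Definition pmmul p q : K1 * K2 := (mmul p.1 q.1, mmul p.2 q.2).

Lemma pmmulA : associative pmmul.
Proof. by move=> p q r; rewrite /pmmul /= !mulmA. Qed.

Lemma pmmul1m : left_id pmone pmmul.
Proof. by case=> a b; rewrite /pmmul /= !mul1m. Qed.

Lemma pmmulm1 : right_id pmone pmmul.
Proof. by case=> a b; rewrite /pmmul /= !mulm1. Qed.

Lemma pmmul_eq1 p q : pmmul p q = pmone -> p = pmone /\ q = pmone.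
Proof. by case: p q => [a b] [c d] [/unitm[-> ->] /unitm[-> ->]]. Qed.

HB.instance Definition _ := Choice_isMonomialDef.Build (K1 * K2)%type
  pmmulA pmmul1m pmmulm1 pmmul_eq1.
End PairMonom.

Lemma pmmulC (K1 K2 : conomType) : commutative (@pmmul K1 K2).
Proof. by move=> p q; rewrite /pmmul mulmC [mmul p.2 _]mulmC. Qed.

HB.instance Definition _ (K1 K2 : conomType) :=
  MonomialDef_isConomialDef.Build (K1 * K2)%type (@pmmulC K1 K2).

Notation Halg := {malg rat[forest]}.
Notation HHalg := {malg rat[(forest * forest)%type]}.

(* Linear extension to {malg rat[K1]} of a map defined on the basis K1. *)
Definition linext (K1 : choiceType) (K2 : monomType)
    (h : K1 -> {malg rat[K2]}) : {malg rat[K1]} -> {malg rat[K2]} :=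
  mmap (@malgC K2 rat) h.

Definition id_Bplus : HHalg -> HHalg :=
  linext (fun p => << (p.1, tree_forest (Bplus p.2)) >>).

Fixpoint ptree_coprod (t : ptree) : HHalg :=
  let: PNode s := t in
  << (tree_forest (mktree (PNode s)), mone) >>
  + id_Bplus (\prod_(d <- map ptree_coprod s) d).

Definition forest_coprod (f : forest) : HHalg :=
  \prod_(t <- finsupp (cmonom_val f)) ptree_coprod (tval t) ^+ f t.

Definition coprod : Halg -> HHalg := linext forest_coprod.

Lemma forest_coprod_mmorphism : mmorphism forest_coprod.
Proof.
split=> [f g|]; last by rewrite /forest_coprod mdom1 big_seq_fset0.
have cE h d : (finsupp (cmonom_val h) `<=` d)%fset ->
    forest_coprod h = \prod_(t <- d) ptree_coprod (tval t) ^+ h t.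
  move=> le_hd; rewrite /forest_coprod (big_fset_incl _ le_hd) // => t _.
  by rewrite -cmE_eq0 => /eqP ->.
rewrite (cE f _ (fsubsetUl _ (finsupp (cmonom_val g)))).
rewrite (cE g _ (fsubsetUr (finsupp (cmonom_val f)) _)).
rewrite /forest_coprod mdomD -big_split.
by apply: eq_bigr => t _; rewrite cmM exprD.
Qed.

HB.instance Definition _ :=
  isMultiplicative.Build forest HHalg forest_coprod forest_coprod_mmorphism.

Lemma coprod_basis f : coprod << f >> = forest_coprod f.
Proof. by rewrite /coprod /linext mmapU mul1r. Qed.

Lemma coprod_linear : linear coprod.
Proof.
move=> c p q; rewrite /coprod /linext raddfD /= mmapZ.
by rewrite mul_malgC.
Qed.

Lemma coprod_multiplicative : multiplicative coprod.
Proof. exact: mmap_is_multiplicative. Qed.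

Lemma ptree_coprod_canon t : ptree_coprod (canon t) = ptree_coprod t.
Proof.
elim/ptree_ind_in: t => s IH.
have mkE : mktree (canon (PNode s)) = mktree (PNode s).
  by apply/val_inj; exact: canon_id.
rewrite [LHS]/= -/(canon (PNode s)) mkE /=; congr (_ + id_Bplus _).
rewrite !big_map (perm_big (map canon s)) ?perm_sort //= big_map !big_seq.
exact: eq_bigr.
Qed.

Lemma forest_coprod_seq f :
  forest_coprod f = \prod_(t <- forest_seq f) ptree_coprod (tval t).
Proof.
rewrite /forest_seq big_flatten big_map; apply: eq_bigr => t _.
by rewrite big_nseq -Monoid.iteropE.
Qed.

Lemma coprod_Bplus f :
  coprod << tree_forest (Bplus f) >>
  = << (tree_forest (Bplus f), mone) >> + id_Bplus (coprod << f >>).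
Proof.
rewrite [X in X = _]coprod_basis [X in id_Bplus X]coprod_basis.
rewrite [X in id_Bplus X]forest_coprod_seq {1}/forest_coprod mdomU.
rewrite big_seq_fset1 cmUU expr1.
by rewrite [LHS]ptree_coprod_canon [LHS]/= !big_map.
Qed.

(* Words in x and y are the free monoid on [bool], with x = false, y = true. *)
Notation hh := {malg rat[{fmonom bool}]}.

Definition hx : hh := << fmu false >>.
Definition hy : hh := << fmu true >>.
Definition hz : hh := hx + hy.

Definition Rmul (u w : hh) : hh := w * u.

Definition in_h0 (w : hh) : Prop :=
  exists (c : rat) (v : hh), w = c *: 1 + hx * v * hy.

Definition in_xhy (w : hh) : Prop := exists v : hh, w = hx * v * hy.

(* M (d (v (x) w)), where d = sum a (x) b acts on v (x) w as
   sum F a v (x) F b w. *)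
Definition Mact (F : forest -> {linear hh -> hh}) (d : HHalg) (v w : hh) : hh :=
  \sum_(p <- msupp d) d@_p *: (F p.1 v * F p.2 w).

Record rooted_forest_maps (F : forest -> {linear hh -> hh}) : Prop := {
  rfm_empty : forall w, F mone w = w;
  rfm_dot_x : F (tree_forest (Bplus mone)) hx = hx * hy;
  rfm_dot_y : F (tree_forest (Bplus mone)) hy = - (hx * hy);
  (* The witness v is R_y^-1 (F f u); it is unique as R_y is injective. *)
  rfm_Bplus : forall f u, f != mone -> u \in [:: hx; hy] ->
    exists v, F f u = Rmul hy v /\
      F (tree_forest (Bplus f)) u = Rmul hy (Rmul (hy + hz) v);
  rfm_mul : forall g h u, g != mone -> h != mone -> u \in [:: hx; hy] ->
    F (mmul g h) u = F g (F h u);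
  rfm_word : forall f w u, f != mone -> u \in [:: hx; hy] ->
    F f (w * u) = Mact F (coprod << f >>) w u
}.

Definition lin_span (S : (hh -> hh) -> Prop) (phi : hh -> hh) : Prop :=
  exists (n : nat) (c : 'I_n -> rat) (g : 'I_n -> hh -> hh),
    (forall i, S (g i)) /\ forall w, phi w = \sum_(i < n) c i *: g i w.

(* Composites R_z^k o t_1 o ... o t_m of tree maps, of total degree n. *)
Definition tree_composite (F : forest -> {linear hh -> hh}) (n : nat)
    (g : hh -> hh) : Prop :=
  exists (k : nat) (ts : seq tree),
    (k + \sum_(t <- ts) deg (tree_forest t))%N = n /\
    forall w, g w = iter k (Rmul hz) (foldr (fun t => F (tree_forest t)) w ts).

Definition psi (F : forest -> {linear hh -> hh}) (f : forest) (w : hh) : hh :=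
  F f (Rmul hx w) - Rmul hx (F f w).

(* Main.v *)
(* The counit and coassociativity laws of the coproduct extend the recursion for
   f(wu) to f(vw), and hence composition of maps to all words; since every
   nonempty f kills z, the maps commute with R_z. Writing phi_f as a polynomial
   in R_z and forest maps, the elements f - R_z phi_f are multiplicative in f,
   so phi is determined by phi_(B f) = f + R_z phi_f and
     phi_(gh) = g phi_h + phi_g h - R_z phi_g phi_h,
   and f(wx) = f(w)x + phi_f(wx)y follows by induction on forests. *)
Require Import Defs.
From HB Require Import structures.
From mathcomp Require Import all_boot all_order all_algebra finmap ring.
From mathcomp.multinomials Require Import monalg.

Set Implicit Arguments.
Unset Strict Implicit.
Unset Printing Implicit Defensive.

Import GRing.Theory.
Local Open Scope ring_scope.

(** * Linear extension of maps given on a basis *)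

(* Unlike [linext], the values are taken in an arbitrary module. *)
HB.lock Definition lext (K : choiceType) (V : lmodType rat) (h : K -> V)
    (d : {malg rat[K]}) : V :=
  \sum_(k <- msupp d) d@_k *: h k.
Arguments lext {K V} h d.

Lemma lextE (K : choiceType) (V : lmodType rat) (h : K -> V) d :
  lext h d = \sum_(k <- msupp d) d@_k *: h k.
Proof. by rewrite lext.unlock. Qed.

Section LinearExtension.
Variables (K : choiceType) (V : lmodType rat).
Implicit Types (h : K -> V) (d e : {malg rat[K]}).

(** Coefficients vanish off the support, so several elements can be summed over one common finite
    set. *)
Lemma lextEw h (s : {fset K}) d : (msupp d `<=` s)%fset ->
  lext h d = \sum_(k <- s) d@_k *: h k.
Proof.
move=> le_ds; rewrite !lextE (big_fset_incl _ le_ds) // => k _ /mcoeff_outdom ->.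
by rewrite scale0r.
Qed.

Lemma lext_is_linear h : linear (lext h).
Proof.
move=> c d e.
have le_s : (msupp (c *: d + e) `<=` msupp d `|` msupp e)%fset.
  apply: (fsubset_trans (msuppD_le _ _)); apply: fsetSU; exact: msuppZ_le.
rewrite (lextEw h le_s) (lextEw h (fsubsetUl (msupp d) (msupp e))).
rewrite (lextEw h (fsubsetUr (msupp d) (msupp e))) scaler_sumr -big_split.
by apply: eq_bigr => k _; rewrite mcoeffD mcoeffZ scalerDl scalerA.
Qed.

HB.instance Definition _ h :=
  GRing.isLinear.Build rat {malg rat[K]} V _ (lext h) (lext_is_linear h).

Lemma lextU h k : lext h << k >> = h k.
Proof. by rewrite (lextEw h msuppU_le) big_seq_fset1 mcoeffUU scale1r. Qed.

Lemma malgZU c (k : K) : << c *g k >> = c *: << k >> :> {malg rat[K]}.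
Proof. by apply/malgP => k'; rewrite mcoeffZ !mcoeffU mulrnAr mulr1. Qed.

Lemma malg_basisE d : d = \sum_(k <- msupp d) d@_k *: << k >>.
Proof. by rewrite {1}[d]monalgE; apply: eq_bigr => k _; exact: malgZU. Qed.

Lemma eq_in_lext h1 h2 d :
  (forall k, k \in msupp d -> h1 k = h2 k) -> lext h1 d = lext h2 d.
Proof. by rewrite !lextE => eq_h; apply: eq_big_seq => k /eq_h ->. Qed.

Lemma eq_lext h1 h2 d : h1 =1 h2 -> lext h1 d = lext h2 d.
Proof. by move=> eq_h; apply: eq_in_lext. Qed.

Lemma lextD h1 h2 d : lext (fun k => h1 k + h2 k) d = lext h1 d + lext h2 d.
Proof. by rewrite !lextE -big_split; apply: eq_bigr => k _; rewrite scalerDr. Qed.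

Lemma lextZ c h d : lext (fun k => c *: h k) d = c *: lext h d.
Proof.
by rewrite !lextE scaler_sumr; apply: eq_bigr => k _; rewrite !scalerA mulrC.
Qed.

Lemma lext0 d : lext (fun=> 0 : V) d = 0.
Proof. by rewrite !lextE big1 // => k _; rewrite scaler0. Qed.

End LinearExtension.

Lemma lext_comp (K : choiceType) (V W : lmodType rat) (f : {linear V -> W})
    (h : K -> V) d : f (lext h d) = lext (fun k => f (h k)) d.
Proof. by rewrite !lextE linear_sum; apply: eq_bigr => k _; rewrite linearZ. Qed.

Lemma lext_lext (K1 K2 : choiceType) (V : lmodType rat) (h : K2 -> V)
    (g : K1 -> {malg rat[K2]}) d :
  lext h (lext g d) = lext (fun k => lext h (g k)) d.
Proof. exact: lext_comp. Qed.

Section LinearExtensionProducts.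
Variable K : monomType.
Implicit Types d e : {malg rat[K]}.

Lemma malgMU (k k' : K) : << k >> * << k' >> = << mmul k k' >> :> {malg rat[K]}.
Proof. by rewrite malgM_def fgmulUU mulr1. Qed.

Lemma lextM (V : lmodType rat) (h : K -> V) d e :
  lext h (d * e) = lext (fun k => lext (fun k' => h (mmul k k')) e) d.
Proof.
rewrite malgME linear_sum.
rewrite [RHS]lextE; apply: eq_bigr => k _.
rewrite linear_sum lextE scaler_sumr; apply: eq_bigr => k' _.
by rewrite malgZU linearZ /= lextU scalerA.
Qed.

Lemma malg_scalerAr c d e : c *: (d * e) = d * (c *: e).
Proof.
apply/malgP => k; rewrite mcoeffZ (mcoeffMlw k (fsubset_refl _) (msuppZ_le c e)).
rewrite mcoeffMl mulr_sumr; apply: eq_bigr => i _; rewrite mulr_sumr.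
by apply: eq_bigr => j _; rewrite mcoeffZ mulrnAr mulrCA.
Qed.

Lemma lext_mull (I : choiceType) (h : I -> {malg rat[K]}) e (d : {malg rat[I]}) :
  lext h d * e = lext (fun k => h k * e) d.
Proof. by rewrite !lextE mulr_suml; apply: eq_bigr => k _; rewrite -scalerAl. Qed.

Lemma lext_mulr (I : choiceType) (h : I -> {malg rat[K]}) e (d : {malg rat[I]}) :
  e * lext h d = lext (fun k => e * h k) d.
Proof.
by rewrite !lextE mulr_sumr; apply: eq_bigr => k _; rewrite -malg_scalerAr.
Qed.

End LinearExtensionProducts.

Lemma lext_morphM (K I : monomType) (h : I -> {malg rat[K]}) :
  (forall i j, h (mmul i j) = h i * h j) ->
  forall d e : {malg rat[I]}, lext h (d * e) = lext h d * lext h e.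
Proof.
move=> hM d e; rewrite lextM lext_mull; apply: eq_lext => i.
by rewrite lext_mulr; apply: eq_lext => j.
Qed.

Lemma linextE (K1 : choiceType) (K2 : monomType) (h : K1 -> {malg rat[K2]}) :
  linext h =1 lext h.
Proof. by move=> d; rewrite !lextE; apply: eq_bigr => k _; rewrite mul_malgC. Qed.

(** * Homogeneous elements for a weight on the basis *)

Section Homogeneous.
Variables (K : choiceType) (w : K -> nat).
Implicit Types d e : {malg rat[K]}.

Definition homog n d : Prop := forall k, k \in msupp d -> w k = n.

Lemma homog0 n : homog n 0.
Proof. by move=> k; rewrite msupp0. Qed.

Lemma homogD n d e : homog n d -> homog n e -> homog n (d + e).
Proof.
move=> dn en k /(fsubsetP (msuppD_le _ _)); rewrite inE => /orP[].
  exact: dn.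
exact: en.
Qed.

Lemma homogZ n c d : homog n d -> homog n (c *: d).
Proof. by move=> dn k /(fsubsetP (msuppZ_le _ _)); exact: dn. Qed.

Lemma homogN n d : homog n d -> homog n (- d).
Proof. by rewrite -scaleN1r; exact: homogZ. Qed.

Lemma homog_lext (I : choiceType) (h : I -> {malg rat[K]}) n (d : {malg rat[I]}) :
  (forall i, i \in msupp d -> homog n (h i)) -> homog n (lext h d).
Proof.
rewrite lextE big_seq => hn; elim/big_ind: _ => [|? ?|i /hn].
- exact: homog0.
- exact: homogD.
- exact: homogZ.
Qed.

End Homogeneous.

Lemma homogM (K : monomType) (w : K -> nat) n m (d e : {malg rat[K]}) :
  {morph w : k k' / mmul k k' >-> (k + k')%N} ->
  homog w n d -> homog w m e -> homog w (n + m) (d * e).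
Proof.
by move=> wM dn em k /msuppM_le[i [j [/dn <- /em <- ->]]]; exact: wM.
Qed.

(** * Induction on rooted forests *)

Local Notation B f := (tree_forest (Bplus f)).

Section Forests.
Implicit Types f g : forest.

Lemma seq_forest_cons t s :
  seq_forest (t :: s) = mmul (tree_forest t) (seq_forest s).
Proof. by rewrite /seq_forest big_cons. Qed.

Lemma deg1 : deg mone = 0%N.
Proof. by rewrite /deg mdom1 big_seq_fset0. Qed.

Lemma tree_forest_neq1 t : tree_forest t != mone.
Proof. by rewrite /tree_forest cm1_eq1. Qed.

(** Strong induction on the degree, then on the list of trees: each tree is [B] of its branches,
    which have one vertex fewer. *)
Lemma forest_ind (P : forest -> Prop) :
  P mone -> (forall f, P f -> P (B f)) ->
  (forall f g, P f -> P g -> P (mmul f g)) -> forall f, P f.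
Proof.
move=> P1 PB PM f; have [n] := ubnP (deg f); elim: n f => // n IH f.
rewrite -[f]forest_seqK; elim: (forest_seq f) => [|t s IHs].
  by rewrite /seq_forest big_nil.
rewrite seq_forest_cons degM -[t]branchesK deg_Bplus => lt_n.
apply: PM; last by apply: IHs; apply: leq_trans lt_n; rewrite ltnS leq_addl.
by apply/PB/IH; apply: leq_trans (leq_addr _ _) _; exact: lt_n.
Qed.

Lemma mmul_eq1 f g : (mmul f g == mone) = (f == mone) && (g == mone).
Proof. exact: cmM_eq1. Qed.

Lemma deg_eq0 f : (deg f == 0%N) = (f == mone).
Proof.
elim/forest_ind: f => [|f _|f g IHf IHg]; first by rewrite deg1 !eqxx.
  by rewrite deg_Bplus (negbTE (tree_forest_neq1 _)).
by rewrite degM addn_eq0 IHf IHg mmul_eq1.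
Qed.

End Forests.

Lemma pair_mulE (K1 K2 : monomType) (a c : K1) (b d : K2) :
  mmul (a, b) (c, d) = (mmul a c, mmul b d).
Proof. by []. Qed.

(** * Grading, counit laws and coassociativity of the coproduct *)

Section Coproduct.
Implicit Types f g : forest.

Lemma forest_coprod1 : forest_coprod mone = << (mone, mone) >>.
Proof. exact: (@mmorph1 forest HHalg forest_coprod). Qed.

Lemma forest_coprodM f g :
  forest_coprod (mmul f g) = forest_coprod f * forest_coprod g.
Proof. exact: (@mmorphM forest HHalg forest_coprod). Qed.

Lemma forest_coprodB f : forest_coprod (B f) =
  << (B f, mone) >> + lext (fun p => << (p.1, B p.2) >>) (forest_coprod f).
Proof.
rewrite -[LHS]coprod_basis coprod_Bplus; congr (_ + _).
rewrite [X in id_Bplus X]coprod_basis; exact: linextE.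
Qed.

(** The grading makes induction on the degree possible: in a term of the coproduct whose right
    factor is nonempty, the left factor has degree below that of [f]. *)
Lemma homog_coprod f :
  homog (fun p : forest * forest => deg p.1 + deg p.2)%N (deg f)
    (forest_coprod f).
Proof.
elim/forest_ind: f => [|f IH|f g IHf IHg].
- rewrite forest_coprod1 => p; rewrite msuppU oner_eq0 inE => /eqP ->.
  by rewrite deg1.
- rewrite forest_coprodB; apply: homogD.
    by move=> p; rewrite msuppU oner_eq0 inE => /eqP ->; rewrite deg1 addn0.
  apply: homog_lext => p /IH pn q; rewrite msuppU oner_eq0 inE => /eqP -> /=.
  by rewrite !deg_Bplus addnS pn.
- rewrite forest_coprodM degM; apply: homogM => // p q.
  by rewrite !degM addnACA.
Qed.

(** The counit kills nonempty forests. Every term in the image of id ⊗ [B] has a nonempty right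
    factor, so only [B f] ⊗ 1 survives. *)
Lemma right_counit f :
  lext (fun p => (p.2 == mone)%:R *: << p.1 >>) (forest_coprod f) = << f >>.
Proof.
elim/forest_ind: f => [|f IH|f g IHf IHg].
- by rewrite forest_coprod1 lextU eqxx scale1r.
- rewrite forest_coprodB linearD /= lextU eqxx scale1r lext_lext.
  rewrite -[RHS]addr0; congr (_ + _); rewrite -[RHS](lext0 _ (forest_coprod f)).
  by apply: eq_lext => p; rewrite lextU /= (negbTE (tree_forest_neq1 _)) scale0r.
- rewrite forest_coprodM lext_morphM; first by rewrite IHf IHg; exact: malgMU.
  move=> p q; rewrite mmul_eq1 -scalerAl -malg_scalerAr scalerA malgMU.
  by rewrite -natrM mulnb.
Qed.

(** Here [B f] ⊗ 1 dies, and the counit on the left factor commutes with [B] on the right one. *)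
Lemma left_counit f :
  lext (fun p => (p.1 == mone)%:R *: << p.2 >>) (forest_coprod f) = << f >>.
Proof.
elim/forest_ind: f => [|f IH|f g IHf IHg].
- by rewrite forest_coprod1 lextU eqxx scale1r.
- rewrite forest_coprodB linearD /= lextU (negbTE (tree_forest_neq1 _)) scale0r.
  rewrite add0r lext_lext -[<< B f >>](lextU (fun g => << B g >>)) -IH lext_lext.
  by apply: eq_lext => p; rewrite lextU linearZ /= lextU.
- rewrite forest_coprodM lext_morphM; first by rewrite IHf IHg; exact: malgMU.
  move=> p q; rewrite mmul_eq1 -scalerAl -malg_scalerAr scalerA malgMU.
  by rewrite -natrM mulnb.
Qed.

Notation HHH := {malg rat[(forest * forest * forest)%type]}.

(** This is (Δ ⊗ id)Δ, and [coprod_right] is (id ⊗ Δ)Δ, on the product basis of the tensor cube. *)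
Definition coprod_left f : HHH :=
  lext (fun p => lext (fun q => << (q, p.2) >>) (forest_coprod p.1))
    (forest_coprod f).

Definition coprod_right f : HHH :=
  lext (fun p => lext (fun q => << ((p.1, q.1), q.2) >>) (forest_coprod p.2))
    (forest_coprod f).

Lemma coprod_leftM f g :
  coprod_left (mmul f g) = coprod_left f * coprod_left g.
Proof.
rewrite /coprod_left forest_coprodM; apply: lext_morphM => -[p p'] [q q'].
rewrite pair_mulE [_.1]/= [_.2]/=.
rewrite forest_coprodM [LHS]lextM [RHS]lext_mull; apply: eq_lext => a.
rewrite [RHS]lext_mulr; apply: eq_lext => b; exact/esym/malgMU.
Qed.

Lemma coprod_rightM f g :
  coprod_right (mmul f g) = coprod_right f * coprod_right g.
Proof.
rewrite /coprod_right forest_coprodM; apply: lext_morphM => -[p p'] [q q'].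
rewrite pair_mulE [_.1]/= [_.2]/=.
rewrite forest_coprodM [LHS]lextM [RHS]lext_mull; apply: eq_lext => a.
rewrite [RHS]lext_mulr; apply: eq_lext => b; exact/esym/malgMU.
Qed.

Definition BB : HHH -> HHH := lext (fun r => << (r.1, B r.2) >>).

Lemma coprod_leftB f : coprod_left (B f) =
  << ((B f, mone), mone) >>
  + lext (fun p => << ((p.1, B p.2), mone) >>) (forest_coprod f)
  + BB (coprod_left f).
Proof.
rewrite /coprod_left [X in lext _ X = _]forest_coprodB [LHS]linearD.
congr (_ + _).
  rewrite [LHS]lextU [(B f, mone).1]/= forest_coprodB [LHS]linearD.
  congr (_ + _); first exact: lextU.
  by rewrite [LHS]lext_lext; apply: eq_lext => p; exact: lextU.
rewrite /BB [LHS]lext_lext [RHS]lext_lext; apply: eq_lext => p.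
rewrite [LHS]lextU [RHS]lext_lext; apply: eq_lext => q; exact/esym/lextU.
Qed.

Lemma coprod_rightB f : coprod_right (B f) =
  << ((B f, mone), mone) >>
  + lext (fun p => << ((p.1, B p.2), mone) >>) (forest_coprod f)
  + BB (coprod_right f).
Proof.
rewrite /coprod_right [X in lext _ X = _]forest_coprodB [LHS]linearD.
rewrite -[RHS]addrA; congr (_ + _).
  by rewrite [LHS]lextU [(B f, mone).2]/= forest_coprod1; exact: lextU.
rewrite /BB [LHS]lext_lext [X in _ = _ + X]lext_lext -[RHS]lextD.
apply: eq_lext => p; rewrite [LHS]lextU [(_, _).2]/= forest_coprodB [LHS]linearD.
congr (_ + _); first exact: lextU.
rewrite [LHS]lext_lext [RHS]lext_lext; apply: eq_lext => q.
by rewrite [LHS]lextU [RHS]lextU.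
Qed.

(** Both sides are multiplicative and obey the same recursion under [B], where [BB] acts as id ⊗ id
    ⊗ [B]. *)
Lemma coprod_coassoc f : coprod_left f = coprod_right f.
Proof.
elim/forest_ind: f => [|f IH|f g IHf IHg].
- rewrite /coprod_left /coprod_right forest_coprod1 [LHS]lextU [RHS]lextU.
  by rewrite forest_coprod1 [LHS]lextU [RHS]lextU.
- by rewrite coprod_leftB coprod_rightB IH.
- by rewrite coprod_leftM coprod_rightM IHf IHg.
Qed.

End Coproduct.

(** * The symbolic phi in the commutative algebra of polynomials in z over H *)

Lemma perm_forest_seqM (f g : forest) :
  perm_eq (forest_seq (mmul f g)) (forest_seq f ++ forest_seq g).
Proof. by apply/allP => t _ /=; rewrite count_cat !count_forest_seq cmM. Qed.

Lemma forest_seq_tree t : forest_seq (tree_forest t) = [:: t].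
Proof.
apply/perm_small_eq => //; rewrite -[tree_forest t](mulm1 (tree_forest t)).
have -> : mmul (tree_forest t) mone = seq_forest [:: t].
  by rewrite seq_forest_cons /seq_forest big_nil.
exact: perm_seq_forest.
Qed.

Lemma addn_eq0_and m n : (m + n = 0 -> m = 0 /\ n = 0)%N.
Proof. by case: m n => [|m] []. Qed.

(** Exponents of z become monomials under addition, so pairs of a forest and an exponent span a
    commutative ring, where [ring] applies. *)
HB.instance Definition _ :=
  Choice_isMonomialDef.Build nat addnA add0n addn0 addn_eq0_and.
HB.instance Definition _ := MonomialDef_isConomialDef.Build nat addnC.

Section SymbolicPhi.
Implicit Types f g : forest.

(* The basis element (f, k) stands for the operator R_z^k o f. *)
Notation P := {malg rat[(forest * nat)%type]}.

Definition zvar : P := << (mone, 1%N) >>.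
Definition fvar f : P := << (f, 0%N) >>.

Lemma fvarM f g : fvar (mmul f g) = fvar f * fvar g.
Proof. by rewrite [RHS]malgMU. Qed.

(** Substituting phi_(B f) = f + z phi_f and z phi_f = f - [residue f] into B f - z phi_(B f) gives
    B f - 2 z f + z [residue f]; this is the recursion used. *)
Fixpoint ptree_residue (t : ptree) : P :=
  let: PNode s := t in
  fvar (tree_forest (mktree (PNode s)))
  - 2%:R * (zvar * fvar (seq_forest (map mktree s)))
  + zvar * \prod_(d <- map ptree_residue s) d.

(* [residue f] is f - R_z phi_f, the combination of f and phi_f that is
   multiplicative in f. *)
Definition residue f : P := \prod_(t <- forest_seq f) ptree_residue (Defs.tval t).

Lemma residue1 : residue mone = 1.
Proof. by rewrite /residue /forest_seq mdom1 big_nil. Qed.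

Lemma residueM f g : residue (mmul f g) = residue f * residue g.
Proof. by rewrite /residue (perm_big _ (perm_forest_seqM f g)) big_cat. Qed.

Lemma residueB f :
  residue (B f) = fvar (B f) - 2%:R * (zvar * fvar f) + zvar * residue f.
Proof.
rewrite {1}/residue forest_seq_tree big_seq1 tval_Bplus /=.
set s := sort _ _; have mkE : mktree (PNode s) = Bplus f.
  by rewrite -tval_Bplus Defs.tvalK.
have brE : seq_forest (map mktree s) = f.
  by rewrite -[RHS]BplusK /branches tval_Bplus.
rewrite mkE brE; congr (_ + _ * _).
by rewrite big_map (perm_big (map Defs.tval (forest_seq f))) ?perm_sort //= big_map.
Qed.

(** Division by z; terms of exponent 0 are sent to 0, so it is a genuine quotient only on multiples
    of z. *)
Definition zdiv : P -> P :=
  lext (fun p => if p.2 is k.+1 then << (p.1, k) >> else 0).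

Lemma zvarK : cancel ( *%R zvar) zdiv.
Proof.
move=> d; rewrite /zdiv {1}/zvar [LHS]lextM [LHS]lextU.
rewrite [RHS]malg_basisE lextE; apply: eq_bigr => -[f k] _.
by rewrite pair_mulE mul1m.
Qed.

Definition sphi f : P := zdiv (fvar f - residue f).

(** The content is that z divides f - [residue f]; by [zvarK] it suffices to exhibit some quotient,
    built by induction on forests. *)
Lemma zvar_sphi f : zvar * sphi f = fvar f - residue f.
Proof.
suff [d dE] : exists d, zvar * d = fvar f - residue f by rewrite /sphi -dE zvarK.
elim/forest_ind: f => [|f [d dE]|f g [d dE] [e eE]].
- by exists 0; rewrite mulr0 residue1 subrr.
- have rE : residue f = fvar f - zvar * d by rewrite dE [RHS]subKr.
  (* With r = f - z d, the difference is 2 z f - z r = z (f + z d). *)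
  exists (fvar f + zvar * d); rewrite residueB rE.
  by move: zvar (fvar f) (fvar (B f)) d {dE rE} => z a b d; ring.
- have rfE : residue f = fvar f - zvar * d by rewrite dE [RHS]subKr.
  have rgE : residue g = fvar g - zvar * e by rewrite eE [RHS]subKr.
  (* Read off from f g - (f - z d)(g - z e). *)
  exists (fvar g * d + fvar f * e - zvar * d * e).
  rewrite residueM rfE rgE fvarM.
  by move: zvar (fvar f) (fvar g) d e {dE eE rfE rgE} => z a b d e; ring.
Qed.

Lemma sphi1 : sphi mone = 0.
Proof.
by apply: (can_inj zvarK); rewrite zvar_sphi residue1 subrr mulr0.
Qed.

Lemma residueE f : residue f = fvar f - zvar * sphi f.
Proof. by rewrite zvar_sphi subKr. Qed.

Lemma sphiB f : sphi (B f) = fvar f + zvar * sphi f.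
Proof.
apply: (can_inj zvarK); rewrite [LHS]zvar_sphi residueB (residueE f).
by move: zvar (fvar f) (fvar (B f)) (sphi f) => z a b c; ring.
Qed.

(** Multiplicativity of the residue, rewritten for phi after cancelling z. *)
Lemma sphiM f g :
  sphi (mmul f g) = fvar f * sphi g + sphi f * fvar g - zvar * sphi f * sphi g.
Proof.
apply: (can_inj zvarK); rewrite [LHS]zvar_sphi residueM fvarM (residueE f) (residueE g).
by move: zvar (fvar f) (fvar g) (sphi f) (sphi g) => z a b c d; ring.
Qed.

(** With z in degree 1, all three terms of the recursion for [B f] have degree [deg f] + 1. *)
Lemma homog_residue f :
  homog (fun p : forest * nat => deg p.1 + p.2)%N (deg f) (residue f).
Proof.
have wM : {morph (fun p : forest * nat => deg p.1 + p.2)%N :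
    p q / mmul p q >-> (p + q)%N}.
  by move=> p q; rewrite /= degM addnACA.
have homog_fvar g : homog (fun p : forest * nat => deg p.1 + p.2)%N (deg g) (fvar g).
  by move=> p; rewrite msuppU oner_eq0 inE => /eqP ->; rewrite addn0.
have homog_zvar : homog (fun p : forest * nat => deg p.1 + p.2)%N 1 zvar.
  by move=> p; rewrite msuppU oner_eq0 inE => /eqP ->; rewrite deg1.
elim/forest_ind: f => [|f IH|f g IHf IHg].
- rewrite residue1 deg1 => p; rewrite msuppU oner_eq0 inE => /eqP ->.
  by rewrite deg1.
- rewrite residueB deg_Bplus; apply: homogD; first apply: homogD.
  + by rewrite -deg_Bplus; exact: homog_fvar.
  + apply: homogN; rewrite mulr_natl -scaler_nat; apply: homogZ.
    rewrite -add1n; exact: homogM wM homog_zvar (homog_fvar f).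
  + rewrite -add1n; exact: homogM wM homog_zvar IH.
- rewrite residueM degM; exact: homogM wM IHf IHg.
Qed.

Lemma homog_sphi f :
  homog (fun p : forest * nat => deg p.1 + p.2)%N (deg f - 1) (sphi f).
Proof.
rewrite /sphi /zdiv; apply: homog_lext => -[g [|k]] pd; first exact: homog0.
have hd : homog (fun p : forest * nat => deg p.1 + p.2)%N (deg f)
    (fvar f - residue f).
  apply: homogD; last by apply: homogN; exact: homog_residue.
  by move=> p; rewrite msuppU oner_eq0 inE => /eqP ->; rewrite addn0.
move=> p; rewrite msuppU oner_eq0 inE => /eqP ->.
(* The exponent is a successor here, so [deg f] is positive and the truncated subtraction is
   exact. *)
by rewrite -(hd _ pd) /= addnS subn1.
Qed.

End SymbolicPhi.

(** * Words: induction on the last letter, and its removal *)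

Section Words.
Implicit Types v w : hh.

Definition letter (b : bool) : hh := << fmu b >>.

Lemma hh_ind (P : hh -> Prop) :
  (forall c v w, P v -> P w -> P (c *: v + w)) -> P 1 ->
  (forall w b, P w -> P (w * letter b)) -> forall w, P w.
Proof.
move=> PD P1 PM w; have P0 : P 0.
  by have := PD (-1) 1 1 P1 P1; rewrite scaleN1r addNr.
rewrite [w]malg_basisE; elim/big_rec: _ => // m v _; apply: PD.
rewrite -[m]fmK; elim/last_ind: (fmonom_val m) => [|s b IH].
  by rewrite -fmoneE.
rewrite (_ : << _ >> = << FMonom s >> * letter b); first exact: PM.
by rewrite /letter malgMU [mmul _ _]fmmulE fmuE /= cats1.
Qed.

(** Inverts right multiplication by either letter, in particular R_y; the empty word is mapped to
    itself by default. *)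
Definition strip : hh -> hh :=
  lext (fun m : {fmonom bool} => << FMonom (take (size m).-1 m) >>).

HB.instance Definition _ := GRing.Linear.on strip.

Lemma stripK w b : strip (w * letter b) = w.
Proof.
rewrite /strip lextM [RHS]malg_basisE lextE; apply: eq_bigr => m _.
rewrite lextU; congr (_ *: << _ >>); apply/val_inj => /=.
by rewrite fmM fmU size_cat addn1 take_size_cat.
Qed.

Lemma letter_inj b : injective (fun w => w * letter b).
Proof. exact: can_inj (stripK ^~ b). Qed.

Lemma hxE : hx = letter false. Proof. by []. Qed.
Lemma hyE : hy = letter true. Proof. by []. Qed.

Lemma letter_in b : letter b \in [:: hx; hy].
Proof. by rewrite !inE hxE hyE; case: b; rewrite eqxx ?orbT. Qed.

End Words.

(** * Rooted forest maps on arbitrary words and products *)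

Section Maps.
Variables (F : forest -> {linear hh -> hh}) (HF : rooted_forest_maps F).
Implicit Types (f g : forest) (v w : hh).

Lemma MactE d v w : Mact F d v w = lext (fun p => F p.1 v * F p.2 w) d.
Proof. by rewrite lextE. Qed.

Lemma right_counitE (V : lmodType rat) (h : forest -> V) f :
  lext (fun p => (p.2 == mone)%:R *: h p.1) (forest_coprod f) = h f.
Proof.
rewrite -[RHS](lextU h) -right_counit [RHS]lext_lext; apply: eq_lext => p.
by rewrite [RHS]linearZ [X in _ = _ *: X]lextU.
Qed.

Lemma left_counitE (V : lmodType rat) (h : forest -> V) f :
  lext (fun p => (p.1 == mone)%:R *: h p.2) (forest_coprod f) = h f.
Proof.
rewrite -[RHS](lextU h) -left_counit [RHS]lext_lext; apply: eq_lext => p.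
by rewrite [RHS]linearZ [X in _ = _ *: X]lextU.
Qed.

Lemma F_word f w b : F f (w * letter b) =
  lext (fun p => F p.1 w * F p.2 (letter b)) (forest_coprod f).
Proof.
have [->|f1] := eqVneq f mone.
  by rewrite forest_coprod1 [RHS]lextU !(rfm_empty HF).
by rewrite (rfm_word HF) ?letter_in // MactE coprod_basis.
Qed.

(** Expand f(1·y) by the coproduct. By induction on the degree, terms with both factors nonempty
    vanish, leaving f(y) = f(y) + f(1) y for nonempty f. *)
Lemma F_one f : F f 1 = (f == mone)%:R *: 1.
Proof.
have [n] := ubnP (deg f); elim: n f => // n IH f lt_f.
have [->|f1] := eqVneq f mone; first by rewrite (rfm_empty HF) scale1r.
rewrite scale0r; apply: (@letter_inj true); rewrite mul0r.
have := F_word f 1 true; rewrite mul1r.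
(* The summand is written as a left-counit part plus a right-counit part; the subtracted term
   corrects the double count at 1 ⊗ 1. *)
rewrite (eq_in_lext (h2 := fun p => (p.1 == mone)%:R *: F p.2 (letter true)
    + (p.2 == mone)%:R *: (F p.1 1 * letter true
                           - (p.1 == mone)%:R *: letter true))); last first.
  move=> p /homog_coprod /= deg_p; have [p2|p2] := eqVneq p.2 mone.
    by rewrite p2 (rfm_empty HF) scale1r addrCA subrr addr0.
  rewrite IH ?scale0r ?addr0 -?scalerAl ?mul1r //.
  rewrite -ltnS; apply: leq_trans lt_f; rewrite ltnS -deg_p -addn1 leq_add2l lt0n.
  by rewrite deg_eq0.
rewrite lextD (left_counitE (fun g => F g (letter true))).
rewrite (right_counitE (fun g => F g 1 * letter true
                           - (g == mone)%:R *: letter true)).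
rewrite (negbTE f1) scale0r subr0 => E.
by apply: (addrI (F f (letter true))); rewrite -E addr0.
Qed.

(** The one-vertex tree has opposite values on x and y; R_y R_(y+z) R_y^-1 is linear and so
    preserves this, and composites send z to 0 as well. *)
Lemma F_hz f : f != mone -> F f hz = 0.
Proof.
elim/forest_ind: f => [|f IH _|f g IHf IHg]; first by rewrite eqxx.
- have [->|f1] := eqVneq f mone.
    by rewrite linearD /= (rfm_dot_x HF) (rfm_dot_y HF) subrr.
  have [vx [fx Bx]] := rfm_Bplus HF f1 (letter_in false).
  have [vy [fy By]] := rfm_Bplus HF f1 (letter_in true).
  (* By induction ([vx] + [vy]) y = 0; stripping y gives [vx] + [vy] = 0. *)
  have := IH f1; rewrite !linearD /= Bx By fx fy /Rmul -!mulrDl.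
  move=> /(congr1 strip); rewrite stripK linear0 => ->.
  by rewrite !mul0r.
- have [->|f1] := eqVneq f mone; first by rewrite mul1m.
  have [->|g1 _] := eqVneq g mone; first by rewrite mulm1.
  rewrite linearD /= !(rfm_mul HF) ?letter_in //.
  by rewrite -linearD -linearD IHg // linear0.
Qed.

(** Nonempty right factors kill z, so only the right-counit term remains. *)
Lemma F_mulz f w : F f (w * hz) = F f w * hz.
Proof.
rewrite mulrDr linearD /= !F_word -lextD.
rewrite -(right_counitE (fun g => F g w * hz)); apply: eq_lext => p.
rewrite -mulrDr -linearD; have [->|p2] := eqVneq p.2 mone.
  by rewrite (rfm_empty HF) scale1r.
by rewrite F_hz // mulr0 scale0r.
Qed.

Lemma F_mulzX f w k : F f (w * hz ^+ k) = F f w * hz ^+ k.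
Proof.
elim: k => [|k IH]; first by rewrite !mulr1.
by rewrite exprSr !mulrA F_mulz IH.
Qed.

(** Induction on the last letter of w: both sides become the sum of [T] over an iterated coproduct,
    and coassociativity identifies them. *)
Lemma F_mul f v w :
  F f (v * w) = lext (fun p => F p.1 v * F p.2 w) (forest_coprod f).
Proof.
elim/hh_ind: w f v => [c w1 w2 IH1 IH2||w b IH] f v.
- rewrite mulrDr -malg_scalerAr linearP IH1 IH2 -lextZ -lextD.
  by apply: eq_lext => p; rewrite linearP mulrDr malg_scalerAr.
- rewrite mulr1 -[LHS](right_counitE (fun g => F g v)); apply: eq_lext => p.
  by rewrite F_one -malg_scalerAr mulr1.
pose T (r : forest * forest * forest) :=
  F r.1.1 v * F r.1.2 w * F r.2 (letter b).
transitivity (lext T (coprod_left f)).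
  rewrite mulrA F_word /coprod_left lext_lext; apply: eq_lext => p.
  rewrite IH lext_mull lext_lext; apply: eq_lext => q.
  by rewrite lextU.
rewrite coprod_coassoc /coprod_right lext_lext; apply: eq_lext => p.
rewrite F_word lext_mulr lext_lext; apply: eq_lext => q.
by rewrite lextU /T mulrA.
Qed.

(** On letters this is part of the definition; it passes to words because the coproduct is
    multiplicative. *)
Lemma F_comp f g w : F (mmul f g) w = F f (F g w).
Proof.
elim/hh_ind: w f g => [c w1 w2 IH1 IH2||w b IH] f g.
- by rewrite !linearP IH1 IH2.
- by rewrite !F_one linearZ /= F_one scalerA -natrM mulnb andbC mmul_eq1.
have F_letter a c : F (mmul a c) (letter b) = F a (F c (letter b)).
  have [->|a1] := eqVneq a mone; first by rewrite mul1m (rfm_empty HF).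
  have [->|c1] := eqVneq c mone; first by rewrite mulm1 (rfm_empty HF).
  by rewrite (rfm_mul HF) ?letter_in.
(* The factors are swapped so that the outer sum runs over the coproduct of [g], the map applied
   first. *)
rewrite [in LHS]mulmC F_word forest_coprodM lextM F_word lext_comp.
apply: eq_lext => q; rewrite F_mul; apply: eq_lext => p.
rewrite -(F_letter p.2) -IH -[mmul p.1 _]mulmC -[mmul p.2 _]mulmC; reflexivity.
Qed.

(** * Evaluation of symbols as operators, and the maps phi *)

Notation P := {malg rat[(forest * nat)%type]}.

Definition ev (d : P) (w : hh) : hh :=
  lext (fun p => F p.1 w * hz ^+ p.2) d.

Lemma ev_is_linear d : linear (ev d).
Proof.
move=> c v w; rewrite /ev -lextZ -lextD; apply: eq_lext => p.
by rewrite linearP mulrDl scalerAl.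
Qed.

HB.instance Definition _ d :=
  GRing.isLinear.Build rat hh hh _ (ev d) (ev_is_linear d).

Lemma evD d e w : ev (d + e) w = ev d w + ev e w.
Proof. exact: linearD. Qed.

Lemma evB d e w : ev (d - e) w = ev d w - ev e w.
Proof. exact: linearB. Qed.

Lemma ev_fvar f w : ev (fvar f) w = F f w.
Proof. by rewrite /ev [LHS]lextU mulr1. Qed.

Lemma ev_zvar w : ev zvar w = w * hz.
Proof. by rewrite /ev [LHS]lextU (rfm_empty HF). Qed.

(** Products of symbols become composites, since forest maps compose by [F_comp] and commute with
    R_z. *)
Lemma evM d e w : ev (d * e) w = ev d (ev e w).
Proof.
rewrite /ev [LHS]lextM; apply: eq_lext => p.
rewrite lext_comp lext_mull; apply: eq_lext => q.
by rewrite F_mulzX -mulrA -exprD addnC -F_comp.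
Qed.

Lemma ev_mulz d w : ev d (w * hz) = ev d w * hz.
Proof. by rewrite -!ev_zvar -!evM mulrC. Qed.

Definition phi f : {linear hh -> hh} := ev (sphi f).

Lemma phi1 w : phi mone w = 0.
Proof. by rewrite /phi /= /ev sphi1 linear0. Qed.

Lemma phiB f w : phi (B f) w = F f w + phi f w * hz.
Proof. by rewrite /phi /= sphiB evD ev_fvar evM ev_zvar. Qed.

Lemma phiM f g w :
  phi (mmul f g) w = F f (phi g w) + phi f (F g w) - phi f (phi g w * hz).
Proof.
rewrite /phi sphiM [LHS]evB evD; congr (_ + _ - _).
- by rewrite [LHS]evM; exact: ev_fvar.
- by rewrite [LHS]evM ev_fvar.
- by rewrite [LHS]evM [LHS]evM ev_zvar; exact/esym/ev_mulz.
Qed.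

Lemma phi_mulz f w : phi f (w * hz) = phi f w * hz.
Proof. exact: ev_mulz. Qed.

(** * The commutator of a forest map with R_x *)

(* psi_(B f)(w) sums a(w) B b(x) over the coproduct of f, and
   B b(x) = R_y R_(y+z) R_y^-1 b(x) for b nonempty; the correction terms are
   those of b empty. *)
Lemma psiB f w : F (B f) (w * hx) = F (B f) w * hx
  + (strip (F f (w * hx)) * ((hy + hz) * hy)
     + F f w * (hx * hy - (hy + hz) * hy)).
Proof.
rewrite hxE F_word forest_coprodB [LHS]linearD; congr (_ + _).
  by rewrite [LHS]lextU [(_, _).2]/= (rfm_empty HF).
rewrite [LHS]lext_lext F_word lext_comp lext_mull.
rewrite -[X in _ = _ + X](right_counitE (fun g =>
  F g w * (hx * hy - (hy + hz) * hy))) -[RHS]lextD.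
apply: eq_lext => p; rewrite [LHS]lextU [(_, _).1]/= [(_, _).2]/=.
have [->|p2] := eqVneq p.2 mone.
  rewrite (rfm_dot_x HF) (rfm_empty HF) /= stripK scale1r -mulrDr.
  by rewrite addrC subrK.
rewrite scale0r addr0.
have [v [-> ->]] := rfm_Bplus HF p2 (letter_in false).
by rewrite /Rmul [F p.1 w * (v * hy)]mulrA /= stripK -!mulrA.
Qed.

(** Applied with a = f(w) and b = phi_f(wx); the right side is then phi_(B f)(wx) y. *)
Lemma psiB_identity (R : pzRingType) (a b x y z : R) :
  (a + b) * ((y + z) * y) + a * (x * y - (y + z) * y)
  = (a * x + b * y + b * z) * y.
Proof.
rewrite mulrDl mulrBr addrC addrA subrK [(y + z) * y]mulrDl mulrDr.
by rewrite !mulrDl !mulrA addrA.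
Qed.

(** Applied with u = g(w), v = phi_g(wx), and a = f(u), p = phi_f(ux), q = f(v), r = phi_f(vx), s =
    phi_f(vy). Then p + s = phi_f(g(wx)) and r + s = phi_f(vz). *)
Lemma psiM_identity (R : pzRingType) (a p q r s x y : R) :
  a * x + p * y + (q * y - r * y) = a * x + (q + (p + s) - (r + s)) * y.
Proof.
by rewrite -mulrBl -addrA -mulrDl [r + s]addrC [q + (_ + s)]addrA addrKA addrCA addrA.
Qed.

(** Subtract the formula for wx from f(wz) = f(w) z. *)
Lemma F_muly_of_mulx f w :
  F f (w * hx) = F f w * hx + phi f (w * hx) * hy ->
  F f (w * hy) = F f w * hy - phi f (w * hx) * hy.
Proof.
move=> E; apply: (addrI (F f (w * hx))); transitivity (F f (w * hz)).
  by rewrite -[LHS]linearD -mulrDr.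
rewrite [LHS]F_mulz [X in _ = X + _]E [LHS]mulrDr.
by move: (F f w * hx) (F f w * hy) (_ * hy) => a b c; rewrite addrACA subrr addr0.
Qed.

Lemma F_mulx f w : F f (w * hx) = F f w * hx + phi f (w * hx) * hy.
Proof.
elim/forest_ind: f w => [|f IH|f g IHf IHg] w.
- by rewrite !(rfm_empty HF) phi1 mul0r addr0.
- have stripE : strip (F f (w * hx)) = F f w + phi f (w * hx).
    (* Both terms of the inductive formula end in a letter, so stripping leaves the sum of the
       prefixes. *)
    by rewrite IH linearD /=; congr (_ + _); exact: stripK.
  rewrite psiB phiB stripE IH; congr (_ + _).
  exact: psiB_identity.
- rewrite !F_comp phiM IHg; move: (phi g _) (F g w) => v u.
  have vzE : phi f (v * hz) = phi f (v * hx) + phi f (v * hy).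
    by rewrite -linearD -mulrDr.
  rewrite linearD [X in X + _]IHf [X in _ + X](F_muly_of_mulx (IHf v)).
  rewrite [X in _ = _ + (_ + X - _) * _]linearD [X in _ = _ + (_ - X) * _]vzE.
  exact: psiM_identity.
Qed.

Lemma F_muly f w : F f (w * hy) = F f w * hy - phi f (w * hx) * hy.
Proof. exact/F_muly_of_mulx/F_mulx. Qed.

(** * Images in x𝔥 and x𝔥y, and the span containing phi *)

Definition preserves_xhh (h : hh -> hh) : Prop :=
  forall w, exists v, h (hx * w) = hx * v.

(** The two claims need a joint induction: phi of [B f] is built from [f] and its phi, and then
    controls [B f] letter by letter. *)
Lemma F_phi_preserves_xhh f :
  preserves_xhh (F f) /\ preserves_xhh (phi f).
Proof.
elim/forest_ind: f => [|f [Ff phif]|f g [Ff phif] [Fg phig]].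
- split=> w; first by exists w; rewrite (rfm_empty HF).
  by exists 0; rewrite phi1 mulr0.
- have phiBf : preserves_xhh (phi (B f)).
    move=> w; have [v vE] := Ff w; have [v' vE'] := phif w.
    by exists (v + v' * hz); rewrite phiB vE vE' [RHS]mulrDr [X in _ = _ + X]mulrA.
  split=> //; elim/hh_ind => [c w1 w2 [v1 E1] [v2 E2]||w b [v vE]].
  + exists (c *: v1 + v2); rewrite mulrDr -malg_scalerAr linearP E1 E2.
    by rewrite mulrDr malg_scalerAr.
  (* The map of [B f] kills 1, so its value at x is phi_(B f)(x) y. *)
  + have [v vE] := phiBf 1; exists (v * hy).
    rewrite mulr1 -[hx in LHS]mul1r F_mulx F_one (negbTE (tree_forest_neq1 _)).
    by rewrite scale0r mul0r add0r mul1r -[hx in LHS]mulr1 vE mulrA.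
  + have [v' vE'] := phiBf (w * hx); rewrite mulrA in vE'.
    case: b; [exists ((v - v') * hy) | exists (v * hx + v' * hy)].
      rewrite [hx * _]mulrA [LHS]F_muly [X in X * _ - _]vE [X in _ - X * _]vE'.
      rewrite -[LHS]mulrBl -[X in X * _]mulrBr.
      exact/esym/mulrA.
    rewrite [hx * _]mulrA [LHS]F_mulx [X in X * _ + _]vE [X in _ + X * _]vE'.
    rewrite [RHS]mulrDr [X in _ = X + _]mulrA [X in _ = _ + X]mulrA; reflexivity.
- split=> w.
    by have [v vE] := Fg w; have [v' vE'] := Ff v; exists v'; rewrite F_comp vE.
  have [v1 E1] := phig w; have [v2 E2] := Ff v1; have [v3 E3] := Fg w.
  have [v4 E4] := phif v3; have [v5 E5] := phif v1.
  exists (v2 + v4 - v5 * hz); rewrite phiM E1 E2 E3 E4 phi_mulz E5.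
  by rewrite [RHS]mulrBr [X in _ = X - _]mulrDr [X in _ = _ - X]mulrA.
Qed.

Lemma F_seq_forest s w :
  F (seq_forest s) w = foldr (fun t => F (tree_forest t)) w s.
Proof.
elim: s => [|t s IH]; first by rewrite /seq_forest big_nil (rfm_empty HF).
by rewrite seq_forest_cons F_comp IH.
Qed.

Lemma iter_Rmul u k w : iter k (Rmul u) w = w * u ^+ k.
Proof. by elim: k => [|k /= ->]; rewrite ?mulr1 // exprSr mulrA. Qed.

(** The terms of [sphi f] are the required composites once each forest is split into its trees;
    homogeneity gives the total degree. *)
Lemma phi_span f : lin_span (tree_composite F (deg f - 1)%N) (phi f).
Proof.
pose s := in_tuple (msupp (sphi f)); pose p i := tnth s i.
exists (size (msupp (sphi f))), (fun i => (sphi f)@_(p i)).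
exists (fun i w => F (p i).1 w * hz ^+ (p i).2); split=> [i|w]; last first.
  by rewrite /phi /= /ev lextE [LHS]big_tnth.
exists (p i).2, (forest_seq (p i).1); split=> [|w]; last first.
  by rewrite -F_seq_forest forest_seqK iter_Rmul.
rewrite -(homog_sphi (mem_tnth i s)) [RHS]addnC -[in RHS](forest_seqK (p i).1).
congr (_ + _)%N; elim: (forest_seq _) => [|t r IH].
  by rewrite big_nil /seq_forest big_nil deg1.
by rewrite big_cons IH seq_forest_cons degM.
Qed.

Lemma in_xhyP c u v : in_xhy u -> in_xhy v -> in_xhy (c *: u + v).
Proof.
move=> [u' ->] [v' ->]; exists (c *: u' + v').
by rewrite [hx * (_ + _)]mulrDr -malg_scalerAr [RHS]mulrDl -scalerAl.
Qed.

(** Since f(1) = 0, one has f(x) = phi_f(x) y = -f(y) and f(xvy) = (f(xv) - phi_f(xvx)) y; f and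
    phi_f preserve the leading x. *)
Lemma F_in_xhy f a b w : f != mone -> in_h0 w ->
  in_xhy (F f (a *: hx + b *: hy + w)).
Proof.
move=> f1 [c [v ->]]; have [F_xhh phi_xhh] := F_phi_preserves_xhh f.
have F1 : F f 1 = 0 by rewrite F_one (negbTE f1) scale0r.
have [v0] := phi_xhh 1; rewrite mulr1 => E0.
have [v1 E1] := F_xhh v; have [v2 E2] := phi_xhh (v * hx).
rewrite mulrA in E2.
have Fx : in_xhy (F f hx).
  by exists v0; have := F_mulx f 1; rewrite !mul1r F1 mul0r add0r E0.
have Fy : in_xhy (F f hy).
  exists (- v0); have := F_muly f 1; rewrite !mul1r F1 mul0r sub0r E0 => ->.
  by rewrite [in RHS]mulrN [RHS]mulNr.
have Fxvy : in_xhy (F f (hx * v * hy)).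
  exists (v1 - v2); rewrite [LHS]F_muly [X in X * _ - _]E1 [X in _ - X * _]E2.
  by rewrite -[LHS]mulrBl -[X in X * _]mulrBr.
rewrite -addrA [F f _]linearP; apply: in_xhyP => //.
rewrite [F f _]linearP; apply: in_xhyP => //.
by rewrite [F f _]linearP F1 scaler0 add0r.
Qed.

End Maps.

Theorem theorem1p2 (F : forest -> {linear hh -> hh})
    (HF : rooted_forest_maps F) :
  exists phi : forest -> {linear hh -> hh},
    forall f g : forest, f != mone -> g != mone ->
    (* (a) *) (forall w, psi F f w = Rmul hy (phi f (Rmul hx w))) /\
    (* (b) *) (forall (a b : rat) (w : hh), in_h0 w ->
                 in_xhy (F f (a *: hx + b *: hy + w))) /\
    (* (c) *) (forall w, phi (tree_forest (Bplus f)) w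
                         = F f w + Rmul hz (phi f w)) /\
    (* (d) *) lin_span (tree_composite F (deg f - 1)%N) (phi f) /\
    (* (e) *) (forall w, F f (F g w) = F g (F f w)) /\
    (* (f) *) (forall v w, F f (v * w) = Mact F (coprod << f >>) v w).
Proof.
exists (phi F) => f g f1 _; split; [|split; [|split; [|split; [|split]]]].
- by move=> w; rewrite /psi /Rmul F_mulx // addrC addKr.
- by move=> a b w; exact: F_in_xhy.
- exact: phiB.
- exact: phi_span.
- by move=> w; rewrite -!F_comp // mulmC.
- by move=> v w; rewrite MactE coprod_basis; exact: F_mul.
Qed.
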